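(* Let $\mathcal{P}$ be a symmetric sign pattern of order $n+m$ with all diagonal entries equal to $0$, whose underlying signed undirected graph is $G(\mathcal{P})=C_n\cdot mP_1$, where $1<m\le n$. Then $\mathcal{P}$ requires full $P$-vertices if and only if the distance between any two consecutive hosts is odd.
   Context: A sign pattern of order $N$ is an $N\times N$ matrix $\mathcal{P}=[p_{ij}]$ with entries in $\{+,-,0\}$; it is symmetric if $p_{ij}=p_{ji}$ for all $i,j$. $\mathcal{Q}_{\mathrm{SYM}}(\mathcal{P})$ is the set of all real symmetric $N\times N$ matrices $A=[a_{ij}]$ with $\mathrm{sgn}(a_{ij})=p_{ij}$ for all $i,j$. The underlying signed undirected graph $G(\mathcal{P})$ has vertices $v_1,\dots,v_N$ and an edge $\{v_i,v_j\}$ exactly when $p_{ij}\neq 0$. $C_n$ is the cycle of length $n$ ($n\ge 3$), and $P_1$ is the path of length $1$ (one edge). The graph $C_n\cdot mP_1$ is obtained by attaching a copy of $P_1$ to each of $m$ distinct vertices of $C_n$, that is, by attaching one pendant vertex to each of these $m$ vertices; the $m$ selected vertices are called hosts. Two hosts are consecutive if they are consecutive among the hosts in the cyclic order around $C_n$. The distance $\mathrm{dist}(u,v)$ between two vertices $u,v$ is the minimum length (number of edges) among all paths from $u$ to $v$ in $G(\mathcal{P})$. For a real symmetric matrix $A$, $m_A(0)$ is the algebraic multiplicity of $0$ as an eigenvalue of $A$ (zero if $0$ is not an eigenvalue), and $A(j)$ is the principal submatrix of $A$ obtained by deleting row and column $j$. The vertex $v_j$ is a $P$-vertex of $A$ if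 $m_{A(j)}(0)-m_A(0)=1$. A symmetric sign pattern $\mathcal{P}$ of order $N$ requires full $P$-vertices if, for every $A\in\mathcal{Q}_{\mathrm{SYM}}(\mathcal{P})$, all $N$ vertices are $P$-vertices of $A$.
   Formalization: The distance between consecutive hosts is taken as the length of the arc of the cycle between them containing no other host (both arcs count when m = 2), not the shortest-path distance in G(P), with which the claim is false (e.g. n = 3, m = 2). *)

(* Defs.v *)
From mathcomp Require Import all_boot all_order all_algebra.
From mathcomp Require Import reals.

Set Implicit Arguments.
Unset Strict Implicit.
Unset Printing Implicit Defensive.

Import Order.TTheory GRing.Theory Num.Theory.
Local Open Scope ring_scope.

Inductive sign := Plus | Minus | Zero.

Definition sgn (R : realType) (x : R) : sign :=
  if x == 0 then Zero else if 0 < x then Plus else Minus.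

Definition QSYM (R : realType) (N : nat) (P : 'M[sign]_N) (A : 'M[R]_N) : Prop :=
  A^T = A /\ forall i j, sgn (A i j) = P i j.

Definition mult0 (R : realType) (N : nat) (A : 'M[R]_N) : nat :=
  mup 0 (char_poly A).

Definition del (R : realType) (N : nat) (A : 'M[R]_N) (j : 'I_N) : 'M[R]_N.-1 :=
  row' j (col' j A).

(* Integer subtraction: the multiplicity may drop when a vertex is deleted. *)
Definition P_vertex (R : realType) (N : nat) (A : 'M[R]_N) (j : 'I_N) : Prop :=
  (mult0 (del A j))%:Z - (mult0 A)%:Z = 1.

Definition requires_full_P_vertices (R : realType) (N : nat) (P : 'M[sign]_N)
    : Prop :=
  forall A : 'M[R]_N, QSYM P A -> forall j : 'I_N, P_vertex A j.

(* ordS is the cyclic successor i |-> i + 1 mod n on 'I_n. *)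
Definition cycle_edge (n : nat) : rel 'I_n :=
  fun u v => (v == ordS u) || (u == ordS v).

(* C_n . m P_1: inl u is the vertex u of the cycle, inr k is the pendant
   vertex attached to the host h k (h is meant to be injective). *)
Definition CnmP1 (n m : nat) (h : 'I_m -> 'I_n) : rel ('I_n + 'I_m)%type :=
  fun x y => match x, y with
  | inl u, inl v => cycle_edge u v
  | inl u, inr k => h k == u
  | inr k, inl u => h k == u
  | inr _, inr _ => false
  end.

(* The graph G(P), in which i and j are adjacent iff P i j <> Zero, is
   isomorphic to the graph e. *)
Definition underlying_graph_is (N : nat) (P : 'M[sign]_N) (V : finType)
    (e : rel V) : Prop :=
  exists f : V -> 'I_N,
    bijective f /\ forall x y, P (f x) (f y) <> Zero <-> e x y.

(* Number of edges of the arc of C_n that runs from u to v in the direction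
   of ordS. *)
Definition arc_length (n : nat) (u v : 'I_n) : nat := ((v + (n - u)) %% n)%N.

(* The host h j is the first one met after h i in the direction of ordS. An
   unordered pair of consecutive hosts occurs in exactly one order if m >= 3,
   and in both orders (once for each of its two arcs) if m = 2. *)
Definition next_host (n m : nat) (h : 'I_m -> 'I_n) (i j : 'I_m) : Prop :=
  i <> j /\
  forall k : 'I_m, ~ (0 < arc_length (h i) (h k) < arc_length (h i) (h j))%N.

(* The distance between consecutive hosts is measured along the arc of the
   cycle that separates them, which contains no other host. It is not the
   length of a shortest path in the whole graph: for n = 3 and m = 2 the hosts
   are adjacent, but the other arc has length 2 and the nonhost on it is not a
   P-vertex; for n = 5 and hosts 0, 1, 2 every vertex is a P-vertex, and the
   arc from 2 to 0 has length 3, but a shortest path goes through host 1 and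
   has length 2. *)
Definition consecutive_hosts_at_odd_distance (n m : nat) (h : 'I_m -> 'I_n)
    : Prop :=
  forall i j : 'I_m, next_host h i j -> odd (arc_length (h i) (h j)).

(* Main.v *)
(** For a real symmetric matrix the multiplicity of [0] is the nullity. Hence
    [j] is not a P-vertex as soon as some kernel vector is nonzero at [j], and
    if every [x] for which [x *m A] vanishes off [j] has [x j = 0], for all [j],
    then [A] is nonsingular with a zero diagonal in its inverse and all vertices
    are P-vertices.

    In such a system the row of a pendant vertex forces the entry at its host,
    and the row of a vertex between two consecutive hosts ties the entries of
    its two neighbours together, so that zeros spread from a host by steps of
    two. If the hosts are at odd distance, every vertex between them is at even
    distance from exactly one of them and is reached from that side without
    using its own row; the entry at a pendant vertex then vanishes by the row of
    its host, whose two cycle neighbours are reached from the far ends of the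
    adjacent arcs. If some distance is even, the arc carries a nonzero solution
    supported at odd distances from its ends, which the pendant vertices
    complete to a kernel vector of the whole matrix. *)

Require Import Defs.
From mathcomp Require Import all_boot all_order all_algebra.
From mathcomp Require Import reals.
From mathcomp Require Import zify.

Set Implicit Arguments.
Unset Strict Implicit.
Unset Printing Implicit Defensive.

Import Order.TTheory GRing.Theory Num.Theory.
Local Open Scope ring_scope.

(** * Multiplicity of 0 as nullity for symmetric matrices *)

Lemma char_poly_intertwine (F : fieldType) (N : nat) (S A B : 'M[F]_N) :
  S \in unitmx -> S *m A = B *m S -> char_poly A = char_poly B.
Proof.
move=> S_unit SAB; set SX := map_mx polyC S.
have SX_det : \det SX != 0.
  by rewrite det_map_mx polyC_eq0 -unitfE -unitmxE.
apply: (mulfI SX_det); rewrite [RHS]mulrC /char_poly -!det_mulmx.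
congr (\det _).
rewrite /char_poly_mx mulmxBr mulmxBl -!map_mxM SAB.
by rewrite scalar_mxC.
Qed.

(** In the basis formed by the rows of [S1] and [S2], [A] becomes block diagonal with blocks 0 and
    [B]. *)
Lemma char_poly_kernel_split (F : fieldType) (k r N : nat) (A : 'M[F]_N)
    (S1 : 'M_(k, N)) (S2 : 'M_(r, N)) (B : 'M_r) :
  (k + r)%N = N -> row_free (col_mx S1 S2) ->
  S1 *m A = 0 -> S2 *m A = B *m S2 -> char_poly A = 'X^k * char_poly B.
Proof.
move=> eqN; case: _ / eqN in A S1 S2 * => S_free S1A S2A.
rewrite (@char_poly_intertwine _ _ (col_mx S1 S2) A (block_mx 0 0 0 B)).
- rewrite /char_poly char_block_diag_mx det_ublock.
  by rewrite /char_poly_mx map_mx0 subr0 det_scalar.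
- by rewrite -row_free_unit.
- by rewrite mul_col_mx S1A S2A mul_block_col !mul0mx !add0r.
Qed.

Lemma row_sqr_eq0 (R : realFieldType) (N : nat) (v : 'rV[R]_N) :
  v *m v^T = 0 -> v = 0.
Proof.
move/matrixP=> /(_ 0 0); rewrite !mxE => /eqP.
rewrite psumr_eq0 => [/allP v0|j _]; last by rewrite !mxE -expr2 sqr_ge0.
apply/rowP=> j; have := v0 j (mem_index_enum _).
by rewrite !mxE -expr2 sqrf_eq0 => /eqP.
Qed.

(** By symmetry the kernel and the row space of [A] are complementary. The kernel contributes a
    power of ['X], and [A] acts injectively on its row space, so 0 is not a root of the remaining
    factor. *)
Lemma mult0_symmetric (R : realType) (N : nat) (A : 'M[R]_N) :
  A^T = A -> mult0 A = (N - \rank A)%N.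
Proof.
move=> A_sym.
(* [v *m A *m A^T *m v^T] is the squared norm of [v *m A]. *)
have ker_sqr m (u : 'M_(m, N)) : u *m A *m A = 0 -> u *m A = 0.
  move=> uAA; apply/row_matrixP=> i; rewrite [RHS]linear0; apply: row_sqr_eq0.
  by rewrite row_mul trmx_mul A_sym mulmxA -!row_mul uAA mul0mx linear0.
set K := row_base (kermx A); set S := row_base A.
have KA : K *m A = 0 by apply/sub_kermxP; rewrite eq_row_base.
have [D SD] : exists D, S *m A = D *m S.
  by apply/submxP; rewrite (submx_trans (submxMl _ _)) // eq_row_base.
have [E SE] : exists E, S = E *m A by apply/submxP; rewrite eq_row_base.
have SA_inj (u : 'rV_(\rank A)) : u *m S *m A = 0 -> u = 0.
  move=> uSA; apply: (row_free_inj (row_base_free A)).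
  by rewrite mul0mx -/S SE mulmxA ker_sqr // -[u *m E *m A]mulmxA -SE.
have KS_free : row_free (col_mx K S).
  rewrite -kermx_eq0; apply/rowV0P=> u /sub_kermxP.
  rewrite -[u]hsubmxK mul_row_col => uKS.
  have u2 : rsubmx u = 0.
    apply: SA_inj; have := congr1 (mulmx^~ A) uKS.
    by rewrite mulmxDl mul0mx -[_ *m K *m A]mulmxA KA mulmx0 add0r.
  have u1 : lsubmx u = 0.
    apply: (row_free_inj (row_base_free (kermx A))); rewrite mul0mx.
    by move: uKS; rewrite u2 mul0mx addr0.
  by rewrite u1 u2 row_mx0.
have eqN : (\rank (kermx A) + \rank A)%N = N.
  by rewrite mxrank_ker subnK // rank_leq_row.
rewrite /mult0 (char_poly_kernel_split eqN KS_free KA SD) mupMl.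
  by rewrite -['X]subr0 -polyC0 mup_XsubCX eqxx mxrank_ker.
rewrite -eigenvalue_root_char; apply/eigenvalueP=> -[v].
rewrite scale0r => vD; apply/negP; rewrite negbK; apply/eqP/SA_inj.
by rewrite -mulmxA SD mulmxA vD mul0mx.
Qed.

(** * Rank after deletion of a vertex, and criteria for P-vertices *)

Lemma row'_decomposition (F : fieldType) (m N : nat) (x : 'rV[F]_m)
    (A : 'M_(m, N)) (j : 'I_m) :
  x *m A = x 0 j *: row j A + col' j x *m row' j A.
Proof.
case: m => [|m] in x A j *; first by case: j.
apply/rowP=> k; rewrite !mxE (bigD1_ord j) //=.
by congr (_ + _); apply: eq_bigr => l _; rewrite !mxE.
Qed.

Lemma rank_row'_le (F : fieldType) (m N : nat) (A : 'M[F]_(m, N)) (j : 'I_m) :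
  (\rank A <= (\rank (row' j A)).+1)%N.
Proof.
have sA : (A <= row j A + row' j A)%MS.
  apply/rV_subP=> _ /submxP[x ->]; rewrite (row'_decomposition x A j).
  by rewrite addmx_sub_adds ?scalemx_sub ?submxMl.
apply: leq_trans (mxrankS sA) _; apply: leq_trans (mxrank_adds_leqif _ _) _.
exact: leq_add (rank_leq_row (row j A)) (leqnn _).
Qed.

(** The relation [x *m A = 0] can be solved for row [j], which is thus a combination of the other
    rows. *)
Lemma rank_row'_eq (F : fieldType) (m N : nat) (x : 'rV[F]_m)
    (A : 'M_(m, N)) (j : 'I_m) :
  x *m A = 0 -> x 0 j != 0 -> \rank (row' j A) = \rank A.
Proof.
move=> xA xj; apply/eqP; rewrite eqn_leq; apply/andP; split.
  by rewrite row'Esub mxrankS ?rowsub_sub.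
apply/mxrankS/rV_subP=> _ /submxP[y ->].
have: x *m A = 0 by [].
rewrite (row'_decomposition x A j) => /(canRL (addrK _)).
rewrite add0r => /(canRL (scalerK xj)) rowj.
rewrite (row'_decomposition y A j) rowj.
by rewrite addmx_sub ?submxMl // -mulNmx !scalemx_sub ?submxMl.
Qed.

Lemma rank_del_eq (F : fieldType) (N : nat) (A : 'M[F]_N) (x : 'rV_N)
    (j : 'I_N) :
  A^T = A -> x *m A = 0 -> x 0 j != 0 -> \rank (row' j (col' j A)) = \rank A.
Proof.
move=> A_sym xA xj; rewrite (@rank_row'_eq _ _ _ x) //.
  by rewrite -mxrank_tr tr_col' A_sym (rank_row'_eq xA xj).
by rewrite col'Esub mulmx_colsub xA linear0.
Qed.

Lemma P_vertex_intro (R : realType) (N : nat) (A : 'M[R]_N) :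
  A^T = A ->
  (forall (x : 'rV_N) j, (forall l, l != j -> (x *m A) 0 l = 0) -> x 0 j = 0) ->
  forall j, P_vertex A j.
Proof.
move=> A_sym vanish j.
have A_free : row_free A.
  rewrite -kermx_eq0; apply/rowV0P=> x /sub_kermxP xA.
  by apply/rowP=> l; rewrite (vanish x l) ?mxE // => k _; rewrite xA mxE.
have rA : \rank A = N by apply/eqP.
have rank_ge : (N <= (\rank (del A j)).+2)%N.
  rewrite -{1}rA; apply: leq_trans (rank_row'_le A j) _; rewrite ltnS.
  by rewrite -mxrank_tr tr_row' A_sym rank_row'_le.
(* Here [x] is row [j] of the inverse. As its entry at [j] vanishes, its other entries form a kernel
   vector of [del A j]; full rank would make [x] zero. Only rank [N - 2] then remains. *)
have rank_lt : \rank (del A j) != N.-1.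
  apply/negP=> del_free; set x := delta_mx 0 j *m invmx A : 'rV_N.
  have xA : x *m A = delta_mx 0 j.
    by rewrite -mulmxA mulVmx ?mulmx1 // -row_free_unit.
  have xj : x 0 j = 0.
    by apply: vanish => l /negPf lj; rewrite xA mxE lj andbF.
  have xdel : col' j x *m del A j = 0.
    have := row'_decomposition x (col' j A) j; rewrite xj scale0r add0r => <-.
    rewrite col'Esub mulmx_colsub xA; apply/rowP=> k.
    by rewrite !mxE eq_sym (negPf (neq_lift _ _)) andbF.
  have x0 : col' j x = 0.
    by apply: (row_free_inj del_free); rewrite xdel mul0mx.
  move/rowP/(_ j): xA; rewrite (row'_decomposition x A j) xj x0.
  by rewrite scale0r mul0mx addr0 !mxE !eqxx => /eqP; rewrite eq_sym oner_eq0.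
rewrite /P_vertex !mult0_symmetric //; last first.
  by apply/matrixP=> k l; rewrite !mxE -[in LHS]A_sym mxE.
have := rank_leq_row (del A j); move: rank_ge rank_lt; rewrite rA.
by case: j => j /= lt_j; lia.
Qed.

Lemma not_P_vertex (R : realType) (N : nat) (A : 'M[R]_N) (x : 'rV_N)
    (j : 'I_N) :
  A^T = A -> x *m A = 0 -> x 0 j != 0 -> ~ P_vertex A j.
Proof.
move=> A_sym xA xj; rewrite /P_vertex !mult0_symmetric //; last first.
  by apply/matrixP=> k l; rewrite !mxE -[in LHS]A_sym mxE.
by rewrite (rank_del_eq A_sym xA xj); lia.
Qed.


(** * Arcs of the cycle and gaps between consecutive hosts *)

Lemma arc_lengthE (n : nat) (u v : 'I_n) :
  arc_length u v = if (u <= v)%N then (v - u)%N else (v + n - u)%N.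
Proof.
have [u_lt v_lt] := (ltn_ord u, ltn_ord v).
rewrite /arc_length; case: leqP => uv.
  by rewrite (_ : v + (n - u) = v - u + n)%N ?modnDr ?modn_small; lia.
by rewrite modn_small; lia.
Qed.

Lemma arc_length_lt (n : nat) (u v : 'I_n) : (arc_length u v < n)%N.
Proof. by rewrite ltn_mod; case: n u v => [[]|]. Qed.

Lemma val_iter_ordS (n d : nat) (u : 'I_n) :
  iter d (@ordS n) u = ((u + d) %% n)%N :> nat.
Proof.
elim: d => [|d IHd] /=; first by rewrite addn0 modn_small.
by rewrite IHd -addn1 modnDml addn1 addnS.
Qed.

Lemma iter_ordS_n (n : nat) (u : 'I_n) : iter n (@ordS n) u = u.
Proof. by apply: val_inj; rewrite /= val_iter_ordS modnDr modn_small. Qed.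

Lemma iter_arc_length (n : nat) (u v : 'I_n) :
  iter (arc_length u v) (@ordS n) u = v.
Proof.
have [u_lt v_lt] := (ltn_ord u, ltn_ord v).
apply: val_inj; rewrite /= val_iter_ordS arc_lengthE; case: leqP => uv.
  by rewrite subnKC // modn_small.
by rewrite (_ : u + _ = v + n)%N ?modnDr ?modn_small; lia.
Qed.

Lemma arc_length_iter (n d : nat) (u : 'I_n) :
  (d < n)%N -> arc_length u (iter d (@ordS n) u) = d.
Proof.
move=> dn; have u_lt := ltn_ord u; rewrite arc_lengthE val_iter_ordS.
have [lt_n|ge_n] := ltnP (u + d)%N n.
  by rewrite modn_small // leq_addr addKn.
rewrite -{1 2 3}(subnK ge_n) !modnDr !modn_small; [|lia..].
by case: leqP; lia.
Qed.

Lemma gap_interior (n m : nat) (h : 'I_m -> 'I_n) (i j k : 'I_m) (d : nat) :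
  next_host h i j -> (0 < d < arc_length (h i) (h j))%N ->
  h k != iter d (@ordS n) (h i).
Proof.
move=> [_ gap] d_in; apply/eqP=> hk; apply: (gap k).
by rewrite hk arc_length_iter //; have := arc_length_lt (h i) (h j); lia.
Qed.

Lemma gap_exists (n m : nat) (h : 'I_m -> 'I_n) (u : 'I_n) :
  (1 < m)%N -> injective h ->
  exists i j d, [/\ next_host h i j, (d < arc_length (h i) (h j))%N
    & u = iter d (@ordS n) (h i)].
Proof.
move=> m_gt1 h_inj.
have i0 : 'I_m by case: m m_gt1 {h h_inj} => // m _; exact: ord0.
(* [h i] is the last host met up to [u], possibly [u] itself. *)
have [i _ min_i] := @arg_minnP _ i0 xpredT (fun i => arc_length (h i) u) isT.
have [j0 j0P] : exists j0, j0 != i.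
  apply/existsP; apply: contraLR m_gt1.
  rewrite negb_exists -leqNgt => /forallP eq_i.
  rewrite -(card_ord m); apply/card_le1_eqP=> k l _ _.
  by rewrite (eqP (negbNE (eq_i k))) (eqP (negbNE (eq_i l))).
have [j ji min_j] :=
  @arg_minnP _ j0 (fun j => j != i) (fun j => arc_length (h i) (h j)) j0P.
have val_neq k : k != i -> (h k != h i :> nat).
  by move=> ki; apply: contra ki => /eqP/val_inj/h_inj ->.
exists i, j, (arc_length (h i) u); split; last by rewrite iter_arc_length.
- split=> [eq_ij|k /andP[k_gt0 k_lt]]; first by rewrite eq_ij eqxx in ji.
  have ki : k != i.
    by apply: contraTneq k_gt0 => ->; rewrite arc_lengthE leqnn subnn.
  by have := min_j k ki; rewrite leqNgt k_lt.
(* If the arc from [h i] to [u] reached [h j], then [h j] would be a closer host before [u]. *)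
- rewrite ltnNge; apply/negP=> le_ju; have := min_i j isT.
  move: le_ju (val_neq j ji) (ltn_ord (h i)) (ltn_ord (h j)) (ltn_ord u).
  rewrite !arc_lengthE.
  by case: (leqP (h i) (h j)); case: (leqP (h i) u); case: (leqP (h j) u); lia.
Qed.

(** * Row equations of a matrix with the given graph *)

Lemma row_pendant (F : fieldType) (n m : nat) (h : 'I_m -> 'I_n)
    (B : 'I_n + 'I_m -> 'I_n + 'I_m -> F) (y : 'I_n + 'I_m -> F) (k : 'I_m) :
  (forall a b, (B a b != 0) = CnmP1 h a b) ->
  \sum_b B (inr k) b * y b = B (inr k) (inl (h k)) * y (inl (h k)).
Proof.
move=> B_graph; rewrite (bigD1 (inl (h k))) //= big1 ?addr0 // => b b_neq.
suff /eqP -> : B (inr k) b == 0 by rewrite mul0r.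
apply/negPn; rewrite B_graph; case: b b_neq => // v.
by apply: contra => /eqP ->.
Qed.

(** Centring the row at [ordS u] makes both cycle neighbours iterates of [ordS]; [2 < n] keeps them
    distinct. *)
Lemma row_cycle (F : fieldType) (n m : nat) (h : 'I_m -> 'I_n)
    (B : 'I_n + 'I_m -> 'I_n + 'I_m -> F) (y : 'I_n -> F) (u : 'I_n) :
  (2 < n)%N -> (forall a b, (B a b != 0) = CnmP1 h a b) ->
  \sum_v B (inl (ordS u)) (inl v) * y v =
    B (inl (ordS u)) (inl u) * y u +
    B (inl (ordS u)) (inl (ordS (ordS u))) * y (ordS (ordS u)).
Proof.
move=> n_gt2 B_graph.
have ssu : ordS (ordS u) != u.
  apply/eqP=> /(congr1 (arc_length u)).
  have /= -> := @arc_length_iter n 2 u n_gt2.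
  by rewrite arc_lengthE leqnn subnn.
rewrite (bigD1 u) //= (bigD1 (ordS (ordS u))) //= big1 ?addr0 // => v.
move=> /andP[vu vssu]; suff /eqP -> : B (inl (ordS u)) (inl v) == 0.
  by rewrite mul0r.
apply/negPn; rewrite B_graph /= /cycle_edge (negPf vssu) /=.
by apply: contra vu => /eqP/ordS_inj ->.
Qed.

Lemma row_host (F : fieldType) (n m : nat) (h : 'I_m -> 'I_n)
    (B : 'I_n + 'I_m -> 'I_n + 'I_m -> F) (y : 'I_n + 'I_m -> F) (k : 'I_m) :
  injective h -> (forall a b, (B a b != 0) = CnmP1 h a b) ->
  \sum_b B (inl (h k)) b * y b =
    \sum_v B (inl (h k)) (inl v) * y (inl v) +
    B (inl (h k)) (inr k) * y (inr k).
Proof.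
move=> h_inj B_graph; rewrite big_sumType /= (bigD1 (P := xpredT) k) //=.
rewrite [\sum_(i | i != k) _]big1 ?addr0 // => l lk.
suff /eqP -> : B (inl (h k)) (inr l) == 0 by rewrite mul0r.
by apply/negPn; rewrite B_graph /=; apply: contra lk => /eqP/h_inj ->.
Qed.

Lemma row_nonhost (F : fieldType) (n m : nat) (h : 'I_m -> 'I_n)
    (B : 'I_n + 'I_m -> 'I_n + 'I_m -> F) (y : 'I_n + 'I_m -> F) (u : 'I_n) :
  (forall a b, (B a b != 0) = CnmP1 h a b) -> (forall k, h k != u) ->
  \sum_b B (inl u) b * y b = \sum_v B (inl u) (inl v) * y (inl v).
Proof.
move=> B_graph u_nonhost; rewrite big_sumType /= [X in _ + X]big1 ?addr0 //.
move=> k _; suff /eqP -> : B (inl u) (inr k) == 0 by rewrite mul0r.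
by apply/negPn; rewrite B_graph /=.
Qed.

(** Each row used lies strictly inside the gap and has just two nonzero coefficients, so the entries
    on its two sides vanish together. Only every second row is used, which allows a missing equation
    to be avoided. *)
Lemma gap_steps (F : fieldType) (n m : nat) (h : 'I_m -> 'I_n)
    (B : 'I_n + 'I_m -> 'I_n + 'I_m -> F) (y : 'I_n + 'I_m -> F)
    (i j : 'I_m) (s k : nat) :
  (2 < n)%N -> (forall a b, (B a b != 0) = CnmP1 h a b) -> next_host h i j ->
  (s + k.*2 <= arc_length (h i) (h j))%N ->
  (forall l, (l < k)%N ->
    \sum_b B (inl (iter (s + l.*2).+1 (@ordS n) (h i))) b * y b = 0) ->
  (y (inl (iter (s + k.*2) (@ordS n) (h i))) == 0)
    = (y (inl (iter s (@ordS n) (h i))) == 0).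
Proof.
move=> n_gt2 B_graph gap; elim: k => [|k IHk] le_D rows; first by rewrite addn0.
rewrite -{}IHk; [|lia|by move=> l lk; apply: rows; lia].
have := rows k (leqnn _); rewrite doubleS !addnS.
rewrite (@row_nonhost _ _ _ h) //; last first.
  by move=> l; apply: gap_interior gap _; lia.
rewrite (@row_cycle _ _ _ h _ (fun v => y (inl v))) //=.
set u := iter _ _ _.
have Bl : B (inl (ordS u)) (inl u) != 0.
  by rewrite B_graph /= /cycle_edge eqxx orbT.
have Br : B (inl (ordS u)) (inl (ordS (ordS u))) != 0.
  by rewrite B_graph /= /cycle_edge eqxx.
move=> row0; apply/eqP/eqP=> y0; move: row0;
  rewrite y0 mulr0 ?addr0 ?add0r => /eqP.
  by rewrite mulf_eq0 (negPf Bl) => /eqP.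
by rewrite mulf_eq0 (negPf Br) => /eqP.
Qed.

(** * Odd gaps force the entry at the exempt vertex to vanish *)

Lemma solution_vanishes (F : fieldType) (n m : nat) (h : 'I_m -> 'I_n)
    (B : 'I_n + 'I_m -> 'I_n + 'I_m -> F) (y : 'I_n + 'I_m -> F)
    (a0 : 'I_n + 'I_m) :
  (2 < n)%N -> (1 < m)%N -> injective h ->
  (forall a b, (B a b != 0) = CnmP1 h a b) ->
  consecutive_hosts_at_odd_distance h ->
  (forall a, a != a0 -> \sum_b B a b * y b = 0) -> y a0 = 0.
Proof.
move=> n_gt2 m_gt1 h_inj B_graph odd_gaps rows.
have host0 k : inr k != a0 -> y (inl (h k)) = 0.
  move=> k_neq; have := rows _ k_neq; rewrite (row_pendant _ _ B_graph) => /eqP.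
  by rewrite mulf_eq0 -[B _ _ == 0]negbK B_graph /= eqxx => /eqP.
case: a0 rows host0 => [u|k] rows host0.
- have {}host0 l : y (inl (h l)) = 0 by exact: host0.
  have [i [j [d [gap lt_d uE]]]] := gap_exists u m_gt1 h_inj.
  have gap_row l : l != d -> (0 < l < arc_length (h i) (h j))%N ->
      \sum_b B (inl (iter l (@ordS n) (h i))) b * y b = 0.
    move=> ld l_in; apply: rows; apply: contra ld => /eqP[].
    have D_lt := arc_length_lt (h i) (h j).
    rewrite uE => /(congr1 (arc_length (h i))).
    by rewrite !arc_length_iter; lia.
  have odd_D := odd_gaps i j gap.
  (* The gap length is odd, so [u] is at even distance from [h j] if [d] is odd and from [h i]
     otherwise. The rows used on the way have positions of parity opposite to [d], hence never that
     of [u]. *)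
  apply/eqP; have [odd_d|even_d] := boolP (odd d); rewrite uE.
    set k := ((arc_length (h i) (h j) - d)./2)%N.
    have endE : (d + k.*2 = arc_length (h i) (h j))%N by rewrite /k; lia.
    rewrite -(@gap_steps _ _ _ h B _ _ j d k) ?endE //.
      by rewrite iter_arc_length host0.
    by move=> l lk; apply: gap_row; lia.
  have endE : (0 + d./2.*2 = d)%N by lia.
  rewrite -[d in iter d]endE (@gap_steps _ _ _ h B _ _ j) ?endE //.
  + by rewrite /= host0.
  + exact: ltnW.
  + by move=> l lk; apply: gap_row; lia.
have cyc_row u : \sum_b B (inl u) b * y b = 0 by exact: rows.
have {}host0 l : l != k -> y (inl (h l)) = 0 by move=> lk; apply: host0.
(* The gap found for [h k] must start there, since its interior contains no host; likewise the gap
   of the predecessor of [h k] must end at [h k]. *)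
have [j gap_next] : exists j, next_host h k j.
  have [i [j [d [gap lt_d uE]]]] := gap_exists (h k) m_gt1 h_inj.
  exists j; suff -> : k = i by [].
  case: d => [|d] in lt_d uE; first exact: h_inj uE.
  by have := gap_interior (d := d.+1) k gap lt_d; rewrite -uE eqxx.
have [i gap_prev] : exists i, next_host h i k.
  have [i [j' [d [gap lt_d uE]]]] := gap_exists (ord_pred (h k)) m_gt1 h_inj.
  exists i; suff -> : k = j' by [].
  have hkE : h k = iter d.+1 (@ordS n) (h i) by rewrite /= -uE ord_predK.
  have [eq_d|neq_d] := eqVneq d.+1 (arc_length (h i) (h j')).
    by apply: h_inj; rewrite hkE eq_d iter_arc_length.
  have d_in : (0 < d.+1 < arc_length (h i) (h j'))%N by lia.
  by have := gap_interior k gap d_in; rewrite -hkE eqxx.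
(* The entry at [h k] itself is unknown, so both neighbours are reached from the opposite ends of
   their gaps. *)
have next0 : y (inl (ordS (h k))) = 0.
  have := odd_gaps _ _ gap_next; set D := arc_length _ _ => odd_D.
  have endE : (1 + D./2.*2 = D)%N by lia.
  apply/eqP; rewrite -[ordS _]/(iter 1 (@ordS n) (h k)).
  rewrite -(@gap_steps _ _ _ h B _ _ j 1 D./2) ?endE //.
  by rewrite iter_arc_length host0 // eq_sym; apply/eqP; case: gap_next.
have prev0 : y (inl (ord_pred (h k))) = 0.
  have := odd_gaps _ _ gap_prev; set D := arc_length _ _ => odd_D.
  have endE : (0 + D./2.*2).+1 = D by lia.
  have -> : ord_pred (h k) = iter (0 + D./2.*2) (@ordS n) (h i).
    by apply: ordS_inj; rewrite ord_predK -iterS endE iter_arc_length.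
  apply/eqP; rewrite (@gap_steps _ _ _ h B _ _ k) //=.
  - by rewrite host0 //; apply/eqP; case: gap_prev.
  - by rewrite -/D; lia.
have := cyc_row (h k); rewrite (row_host _ _ h_inj B_graph).
rewrite -(ord_predK (h k)) (row_cycle (fun v => y (inl v)) _ n_gt2 B_graph).
rewrite ord_predK prev0 next0 !mulr0 !add0r => /eqP.
by rewrite mulf_eq0 -[B _ _ == 0]negbK B_graph /= eqxx => /eqP.
Qed.

(** * A kernel vector supported on an even gap and on pendant vertices *)

Fixpoint gap_coef (F : fieldType) (p q : nat -> F) (d : nat) : F :=
  match d with
  | 0 => 0
  | 1 => 1
  | d'.+2 => - (p d' * gap_coef p q d') / q d'
  end.

Lemma gap_coef_even (F : fieldType) (p q : nat -> F) (d : nat) :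
  ~~ odd d -> gap_coef p q d = 0.
Proof.
move=> even_d; rewrite -(even_halfK even_d).
by elim: d./2 => //= k ->; rewrite mulr0 oppr0 mul0r.
Qed.

Lemma even_gap_kernel (F : fieldType) (n m : nat) (h : 'I_m -> 'I_n)
    (B : 'I_n + 'I_m -> 'I_n + 'I_m -> F) (i j : 'I_m) :
  (2 < n)%N -> injective h -> (forall a b, (B a b != 0) = CnmP1 h a b) ->
  next_host h i j -> ~~ odd (arc_length (h i) (h j)) ->
  exists y : 'I_n + 'I_m -> F,
    (forall a, \sum_b B a b * y b = 0) /\ y (inl (ordS (h i))) != 0.
Proof.
move=> n_gt2 h_inj B_graph gap; set D := arc_length _ _ => even_D.
have D_lt : (D < n)%N by exact: arc_length_lt.
have D_gt0 : (0 < D)%N.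
  rewrite lt0n; apply/negP=> /eqP D0; case: gap => ij _; apply/ij/h_inj.
  by rewrite -(iter_arc_length (h i) (h j)) -/D D0.
pose z d := iter d (@ordS n) (h i).
(* The row of [z d.+1] is a two-term relation between [c d] and [c d.+2]. Starting from 0 and 1, [c]
   solves it and vanishes at even positions, in particular at both ends of the gap. *)
pose c := gap_coef (fun d => B (inl (z d.+1)) (inl (z d)))
                   (fun d => B (inl (z d.+1)) (inl (z d.+2))).
pose y0 u := let d := arc_length (h i) u in if (d < D)%N then c d else 0.
have y0_host k : y0 (h k) = 0.
  rewrite /y0; case: ifP => // lt_D.
  have [-> //|d_gt0] := posnP (arc_length (h i) (h k)).
  case: gap => _ /(_ k) []; by rewrite d_gt0.
(* The case [d = n] wraps around to [h i]; it occurs as the right neighbour in the row of the last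
   vertex. *)
have y0_z d : (d <= n)%N -> y0 (z d) = if (d < D)%N then c d else 0.
  rewrite leq_eqVlt => /orP[/eqP ->|d_lt]; last by rewrite /y0 arc_length_iter.
  by rewrite /z iter_ordS_n y0_host ltnNge ltnW.
have y0_row u : (forall k, h k != u) -> \sum_v B (inl u) (inl v) * y0 v = 0.
  move=> u_nonhost; set d := arc_length (h i) (ord_pred u).
  have uE : u = z d.+1 by rewrite /z /= iter_arc_length ord_predK.
  have dS_lt : (d.+1 < n)%N.
    rewrite ltn_neqAle arc_length_lt andbT; apply/eqP=> d_n.
    by have := u_nonhost i; rewrite uE d_n /z iter_ordS_n eqxx.
  have dS_neq : d.+1 != D.
    apply/eqP=> d_D; have := u_nonhost j.
    by rewrite uE d_D /z iter_arc_length eqxx.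
  have zS e : z e.+1 = ordS (z e) by [].
  rewrite uE zS (row_cycle y0 _ n_gt2 B_graph) -!zS.
  rewrite (y0_z d.+2) // (y0_z d); last exact: ltnW (ltnW dS_lt).
  have [d_odd|d_even] := boolP (odd d); last first.
    rewrite /c !gap_coef_even //= ?negbK //.
    by rewrite !if_same !mulr0 addr0.
  have [lt_D|ge_D] := ltnP d D; last first.
    by rewrite ltnNge (leq_trans ge_D) ?mulr0 ?addr0 //; lia.
  (* Parity excludes [d.+2 = D], and [d.+1 = D] would make [u] a host. *)
  rewrite (_ : d.+2 < D)%N; last by lia.
  have -> : c d.+2 = - (B (inl (z d.+1)) (inl (z d)) * c d)
      / B (inl (z d.+1)) (inl (z d.+2)) by [].
  rewrite [X in _ + X]mulrC divfK ?addrN // B_graph /= /cycle_edge.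
  by rewrite eqxx.
(* The entry at a pendant vertex is chosen to solve the row of its host; its own row holds because
   [y0] vanishes at hosts. *)
pose y a := match a with
  | inl u => y0 u
  | inr k => - (\sum_v B (inl (h k)) (inl v) * y0 v) / B (inl (h k)) (inr k)
  end.
have B_host k : B (inl (h k)) (inr k) != 0 by rewrite B_graph /=.
exists y; split; last first.
  rewrite -[y _]/(y0 (z 1%N)) y0_z; last by lia.
  by rewrite (_ : 1 < D)%N ?oner_neq0 //; lia.
case=> [u|k]; last by rewrite (row_pendant _ _ B_graph) /= y0_host mulr0.
have [/existsP[k /eqP <-]|] := boolP [exists k, h k == u].
  by rewrite (row_host _ _ h_inj B_graph) /= mulrC divfK // addrN.
rewrite negb_exists => /forallP u_nonhost.
by rewrite (row_nonhost _ B_graph u_nonhost) y0_row.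
Qed.

(** * From matrices to sign patterns *)

Definition sign_matrix (R : realType) (N : nat) (P : 'M[sign]_N) : 'M[R]_N :=
  \matrix_(i, j) match P i j with Plus => 1 | Minus => -1 | Zero => 0 end.

Lemma sign_matrix_QSYM (R : realType) (N : nat) (P : 'M[sign]_N) :
  P^T = P -> QSYM P (sign_matrix R P).
Proof.
move=> P_sym; split=> [|i j].
  by apply/matrixP=> i j; rewrite !mxE -[in RHS]P_sym mxE.
rewrite mxE /sgn; case: (P i j); rewrite ?eqxx ?oner_eq0 ?ltr01 //.
by rewrite oppr_eq0 oner_eq0 ltr0N1.
Qed.

Lemma sgn_eq_Zero (R : realType) (x : R) : sgn x <> Zero <-> x != 0.
Proof. by rewrite /sgn; case: ifP => // _; case: ifP. Qed.

Theorem theorem3p6 (R : realType) (n m : nat) (hn : (3 <= n)%N)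
    (hm : (1 < m <= n)%N) (h : 'I_m -> 'I_n) (h_inj : injective h)
    (P : 'M[sign]_(n + m)) (P_sym : (P^T)%R = P)
    (P_diag : forall i, P i i = Zero)
    (P_graph : underlying_graph_is P (CnmP1 h)) :
  requires_full_P_vertices R P <-> consecutive_hosts_at_odd_distance h.
Proof.
have [m_gt1 _] := andP hm.
have [f [[g fK gK] f_graph]] := P_graph.
have f_bij : {on [pred _ | true], bijective f}.
  by apply: onW_bij; exists g.
(* The indices are transposed to match [x *m A], whose entry at [f a] runs down a column of [A]. *)
have graph_of (A : 'M[R]_(n + m)) : QSYM P A ->
    forall a b, (A (f b) (f a) != 0) = CnmP1 h a b.
  move=> [A_sym A_sgn] a b; rewrite -[in LHS]A_sym mxE; apply/idP/idP.
    by move/sgn_eq_Zero; rewrite A_sgn => /f_graph.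
  by move/f_graph; rewrite -A_sgn => /sgn_eq_Zero.
have row_mulE (A : 'M[R]_(n + m)) (x : 'rV_(n + m)) a :
    (x *m A) 0 (f a) = \sum_b A (f b) (f a) * x 0 (f b).
  rewrite mxE (reindex f) //=.
  by apply: eq_bigr => b _; rewrite mulrC.
split=> [full i j gap|odd_gaps A A_P].
- apply/negPn/negP=> even_gap.
  (* One matrix of the class suffices as a counterexample, here the one with entries 0, 1 and -1. *)
  have A_P := sign_matrix_QSYM R P_sym; have A_graph := graph_of _ A_P.
  have [y [y_ker y_neq0]] := even_gap_kernel hn h_inj A_graph gap even_gap.
  apply: (@not_P_vertex _ _ _ (\row_l y (g l)) (f (inl (ordS (h i)))) A_P.1).
  + apply/rowP=> l; rewrite -(gK l) row_mulE mxE -[RHS](y_ker (g l)).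
    by apply: eq_bigr => b _; rewrite [X in _ * X = _]mxE fK.
  + by rewrite mxE fK.
  + exact: full A_P _.
- apply: P_vertex_intro A_P.1 _ => x j rows.
  rewrite -(gK j); apply: (solution_vanishes (y := fun a => x 0 (f a))
    hn m_gt1 h_inj (graph_of A A_P) odd_gaps) => a a_neq.
  rewrite -row_mulE rows // -(gK j).
  by apply: contra a_neq => /eqP/(can_inj fK) ->.
Qed.
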